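(* Let $$I_2=\begin{pmatrix}1&0\\0&1\end{pmatrix},\quad U=\begin{pmatrix}\frac12&\frac{\sqrt3}{2}\\ \frac{\sqrt3}{2}&-\frac12\end{pmatrix},\quad V=\begin{pmatrix}\frac12&-\frac{\sqrt3}{2}\\ \frac{\sqrt3}{2}&\frac12\end{pmatrix},$$ and let $D$ be a diagonal operator on $\ell^2(\mathbb{Z})$ with $\|D\|\le1$ and $\mathbb{T}\subset\sigma(D)$. On $\mathbb{L}=\mathbb{C}^2\oplus\ell^2(\mathbb{Z})$ put $\tilde T_1=I_2\oplus D$, $\tilde T_2=U\oplus D$, $\tilde T_3=V\oplus D$, and on $\mathbb{L}\otimes\mathbb{L}\otimes\mathbb{L}$ put $\hat T_1=\tilde T_1\otimes I\otimes I$, $\hat T_2=I\otimes\tilde T_2\otimes I$, $\hat T_3=I\otimes I\otimes\tilde T_3$. On $\mathbb{K}=(\mathbb{L}\otimes\mathbb{L}\otimes\mathbb{L})\oplus\mathbb{C}^2$ put $S_1=\hat T_1\oplus I_2$, $S_2=\hat T_2\oplus U$, $S_3=\hat T_3\oplus V$, and define the linear map $S:\ell^1(3)\to\mathcal{B}(\mathbb{K})$ by $S(z_1,z_2,z_3)=z_1S_1+z_2S_2+z_3S_3$. Then $S$ is an isometry, and the operator space structure on $\ell^1(3)$ induced by $S$ is not completely isometric to $\mathrm{MIN}(\ell^1(3))$.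
   Context: $\ell^1(3)$ denotes $\mathbb{C}^3$ with the norm $\|(z_1,z_2,z_3)\|_1=|z_1|+|z_2|+|z_3|$. $\mathbb{T}$ is the unit circle in $\mathbb{C}$; $\sigma(D)$ is the spectrum of $D$; a diagonal operator on $\ell^2(\mathbb{Z})$ is one that is diagonal with respect to the standard orthonormal basis; $\otimes$ of Hilbert spaces is the Hilbert space tensor product. $M_k(W)$ is the space of $k\times k$ matrices with entries in $W$, and $M_k=M_k(\mathbb{C})$ carries the operator norm. Induced operator space structure: if $W$ is a normed linear space and $\phi:W\to\mathcal{B}(\mathbb{H})$ is a linear isometry, the operator space structure on $W$ induced by $\phi$ is the sequence of norms $\|(w_{ij})\|_k=\|(\phi(w_{ij}))\|$ on $M_k(W)$, $k\ge1$, where $(\phi(w_{ij}))$ is regarded as an operator on $\mathbb{H}\oplus\cdots\oplus\mathbb{H}$ ($k$ copies). $\mathrm{MIN}(W)$ is $W$ with the norms $\|(w_{ij})\|_{\mathrm{MIN}}=\sup\{\|(f(w_{ij}))\|_{M_k}: f\in (W^* )_1\}$ on $M_k(W)$, $k\ge1$, where $(W^* )_1$ is the closed unit ball of the dual space $W^*$. Two operator spaces $(W,\|\cdot\|_k)$ and $(W',\|\cdot\|_k)$ are completely isometric if there is a linear bijection $T:W\to W'$ such that for every $k\ge 1$ the entrywise map $M_k(W)\to M_k(W')$, $(w_{ij})\mapsto(Tw_{ij})$, is an isometry. *)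

(* Defs.v *)
From HB Require Import structures.
From mathcomp Require Import all_boot all_order all_algebra.
From mathcomp Require Import complex ring lra.
From mathcomp Require Import all_classical all_reals all_analysis.
Set Implicit Arguments.
Unset Strict Implicit.
Unset Printing Implicit Defensive.
Import Order.TTheory GRing.Theory Num.Theory.
Import numFieldNormedType.Exports.
Local Open Scope classical_set_scope.
Local Open Scope ring_scope.

(* Norms of R[i]-spaces have values in R[i]; nrm is the same norm seen in R. *)
Definition nrm (R : realType) (V : normedZmodType R[i]) (v : V) : R :=
  complex.Re `|v|.

Section Nrm.
Context {R : realType}.

Lemma nrmE (V : normedZmodType R[i]) (v : V) : (nrm v)%:C%C = `|v|.
Proof. by rewrite /nrm RRe_real ?normr_real. Qed.

Lemma nrm_ge0 (V : normedZmodType R[i]) (v : V) : 0 <= nrm v.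
Proof. by rewrite -lecR nrmE; exact: normr_ge0. Qed.

Lemma nrm_eq0 (V : normedZmodType R[i]) (v : V) : nrm v = 0 -> v = 0.
Proof. by move=> v0; apply/normr0_eq0; rewrite -nrmE v0. Qed.

Lemma nrm0 (V : normedZmodType R[i]) : nrm (0 : V) = 0.
Proof. by rewrite /nrm normr0. Qed.

Lemma ler_nrmD (V : normedZmodType R[i]) (v w : V) :
  nrm (v + w) <= nrm v + nrm w.
Proof. by rewrite -lecR rmorphD/= !nrmE ler_normD. Qed.

Lemma ler_nrm_sum (V : normedZmodType R[i]) (J : finType) (F : J -> V) :
  nrm (\sum_j F j) <= \sum_j nrm (F j).
Proof.
elim/big_rec2: _ => [|j y v _ vy]; first by rewrite nrm0.
by apply: le_trans (ler_nrmD _ _) _; rewrite lerD2l.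
Qed.

Lemma nrmM (c d : R[i]) : nrm (c * d) = nrm c * nrm d.
Proof. by apply/complexI; rewrite rmorphM/= !nrmE normrM. Qed.

Lemma nrm_sqD (c d : R[i]) : nrm (c + d) ^+ 2 <= 2 * (nrm c ^+ 2 + nrm d ^+ 2).
Proof.
apply: (@le_trans _ _ ((nrm c + nrm d) ^+ 2)).
  by rewrite lerXn2r ?nnegrE ?addr_ge0 ?nrm_ge0 ?ler_nrmD.
rewrite -subr_ge0 (_ : _ - _ = (nrm c - nrm d) ^+ 2) ?sqr_ge0//.
by ring.
Qed.

End Nrm.

(* C^n under a new name, so that it carries the 1-norm and not the maximum norm
   that the library puts on row vectors. *)
Definition ell1 (R : realType) (n : nat) := 'rV[R[i]]_n.

Section Ell1.
Context {R : realType} {n : nat}.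

HB.instance Definition _ := GRing.Lmodule.on (ell1 R n).

Definition ell1_norm (z : ell1 R n) : R[i] := \sum_i `|z 0 i|.

Lemma ler_ell1_normD x y : ell1_norm (x + y) <= ell1_norm x + ell1_norm y.
Proof.
by rewrite -big_split ler_sum//= => i _; rewrite mxE ler_normD.
Qed.

Lemma ell1_normZ (l : R[i]) x : ell1_norm (l *: x) = `|l| * ell1_norm x.
Proof. by rewrite mulr_sumr; apply: eq_bigr => i _; rewrite mxE normrM. Qed.

Lemma ell1_norm0_eq0 x : ell1_norm x = 0 -> x = 0.
Proof.
move/eqP; rewrite psumr_eq0// => /allP x0; apply/rowP => i.
by rewrite mxE; apply/eqP; rewrite -normr_eq0; exact: (x0 i (mem_index_enum _)).
Qed.

HB.instance Definition _ :=
  Lmodule_isNormed.Build R[i] (ell1 R n) ler_ell1_normD ell1_normZ ell1_norm0_eq0.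

End Ell1.

Section Esum.
Context {R : realType}.
Local Open Scope ereal_scope.

Lemma esum_sumtype (I J : choiceType) (a : I + J -> \bar R) :
  (forall k, 0 <= a k) ->
  \esum_(k in [set: I + J]) a k =
  \esum_(i in [set: I]) a (inl i) + \esum_(j in [set: J]) a (inr j).
Proof.
move=> a0; rewrite (esumID (range inl))// !setTI; congr (_ + _).
- apply: (reindex_esum setT (range inl) inl); split => //.
  by move=> k l _ _ [].
- apply: (reindex_esum setT (~` range inl) inr); split.
  + by move=> j _ [k].
  + by move=> k l _ _ [].
  + by case=> [i []|j _]; [exists i|exists j].
Qed.

Lemma esum_prodtype (I J : choiceType) (a : I * J -> \bar R) :
  (forall k, 0 <= a k) ->
  \esum_(k in [set: I * J]) a k =
  \esum_(i in [set: I]) \esum_(j in [set: J]) a (i, j).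
Proof.
move=> a0; rewrite (@esum_esum _ _ _ _ (fun=> setT) (fun i j => a (i, j)))//.
rewrite (_ : _ `*`` _ = setT); last by apply/seteqP; split.
by apply: eq_esum => -[].
Qed.

Lemma esum_prodtypeC (I J : choiceType) (a : I * J -> \bar R) :
  (forall k, 0 <= a k) ->
  \esum_(k in [set: I * J]) a k =
  \esum_(j in [set: J]) \esum_(i in [set: I]) a (i, j).
Proof.
move=> a0; rewrite -(@esum_prodtype _ _ (fun k => a (k.2, k.1)))//.
apply: (reindex_esum setT setT (fun k : J * I => (k.2, k.1))).
by split => //; [move=> [? ?] [? ?] _ _ [-> ->]|move=> [i j] _; exists (j, i)].
Qed.

Lemma esumZ (I : choiceType) (M : R) (a : I -> \bar R) :
  (0 <= M)%R -> (forall i, 0 <= a i) ->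
  \esum_(i in [set: I]) (M%:E * a i) <= M%:E * \esum_(i in [set: I]) a i.
Proof.
move=> M0 a0; apply: ge_ereal_sup => _ [X [finX _] <-].
rewrite -ge0_mule_fsumr//; apply: lee_wpmul2l; first by rewrite lee_fin.
by apply: ereal_sup_ubound; exists X.
Qed.

End Esum.

Section Ell2.
Context {R : realType} {I : choiceType}.
Local Open Scope ereal_scope.

Definition sqsum (x : I -> R[i]) : \bar R :=
  \esum_(i in [set: I]) ((nrm (x i)) ^+ 2)%:E.

Definition ell2_pred : {pred I -> R[i]^o} := mem [set x | sqsum x < +oo].

Lemma sqsum_ge0 x : 0 <= sqsum x.
Proof. by apply: esum_ge0 => i _; rewrite lee_fin sqr_ge0. Qed.

Lemma sqsum0 : sqsum (fun=> 0%R : R[i]) = 0.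
Proof. by apply: esum1 => i _; rewrite nrm0 expr0n. Qed.

Lemma sqsumD x y : sqsum (fun i => x i + y i)%R <= 2%:E * (sqsum x + sqsum y).
Proof.
rewrite -esumD; [|by move=> i _; rewrite lee_fin sqr_ge0..].
apply: le_trans (esumZ _ _) => //.
  by apply: le_esum => i _; rewrite -EFinD -EFinM lee_fin nrm_sqD.
by move=> i; rewrite -EFinD lee_fin addr_ge0 ?sqr_ge0.
Qed.

Lemma sqsumZ (c : R[i]) x : sqsum (fun i => c * x i)%R <= (nrm c ^+ 2)%:E * sqsum x.
Proof.
apply: le_trans (esumZ _ _) => //.
- by apply: le_esum => i _; rewrite -EFinM lee_fin nrmM exprMn.
- exact: sqr_ge0.
- by move=> i; rewrite lee_fin sqr_ge0.
Qed.

Lemma ell2_submod_closed : submod_closed ell2_pred.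
Proof.
split=> [|c x y].
  by rewrite inE /= sqsum0.
rewrite !inE /= => xoo yoo; apply: le_lt_trans (sqsumD _ _) _.
rewrite lte_mul_pinfty// lte_add_pinfty//.
apply: le_lt_trans (sqsumZ _ _) _.
by rewrite lte_mul_pinfty// lee_fin sqr_ge0.
Qed.

HB.instance Definition _ :=
  GRing.isSubmodClosed.Build R[i] (I -> R[i]^o) ell2_pred ell2_submod_closed.

End Ell2.

(* The Hilbert space l^2(I), with pointwise operations. In particular C^n is
   ell2 R 'I_n and l^2(Z) is ell2 R int. *)
Record ell2 (R : realType) (I : choiceType) :=
  Ell2 { ell2_val :> I -> R[i]^o; _ : ell2_val \in ell2_pred }.


Section Ell2Space.
Context {R : realType} {I : choiceType}.

HB.instance Definition _ := [isSub for @ell2_val R I].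
HB.instance Definition _ := [Choice of ell2 R I by <:].
HB.instance Definition _ := [SubChoice_isSubLmodule of ell2 R I by <:].

Definition ell2_norm (x : ell2 R I) : R := Num.sqrt (fine (sqsum x)).

Lemma ell2_norm_ge0 x : 0 <= ell2_norm x.
Proof. exact: sqrtr_ge0. Qed.

Lemma sqsumE (x : ell2 R I) : sqsum x = (ell2_norm x ^+ 2)%:E.
Proof.
rewrite sqr_sqrtr; last by rewrite fine_ge0// sqsum_ge0.
rewrite fineK// ge0_fin_numE ?sqsum_ge0//.
by case: x => x /=; rewrite inE.
Qed.

Lemma ell2_coord (x : ell2 R I) i : nrm (x i) <= ell2_norm x.
Proof.
rewrite -ler_sqr ?nnegrE ?nrm_ge0 ?ell2_norm_ge0// -lee_fin -sqsumE.
apply: esum_ge; exists [set i]; first by split => //; exact: finite_set1.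
by rewrite fsbig_set1.
Qed.

End Ell2Space.

Lemma sqsum_inj (R : realType) (I J : choiceType) (e : J -> I) (x : I -> R[i]) :
  injective e -> (sqsum (x \o e) <= sqsum x)%E.
Proof.
move=> inje; rewrite {2}/sqsum (esumID (range e)); last first.
  by move=> i _; rewrite lee_fin sqr_ge0.
rewrite !setTI -[leLHS]adde0 leeD//; last first.
  by apply: esum_ge0 => i _; rewrite lee_fin sqr_ge0.
rewrite (reindex_esum setT (range e) e)//.
by split => // j k _ _ /inje.
Qed.

Lemma ell2_sub_subproof (R : realType) (I J : choiceType) (e : J -> I)
  (inje : injective e) (x : ell2 R I) : (x \o e : J -> R[i]^o) \in ell2_pred.
Proof.
by rewrite inE /=; apply: le_lt_trans (sqsum_inj _ inje) _; rewrite sqsumE ltry.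
Qed.

Definition ell2_sub (R : realType) (I J : choiceType) (e : J -> I)
    (inje : injective e) (x : ell2 R I) : ell2 R J :=
  Ell2 (ell2_sub_subproof inje x).

Lemma ell2_subE (R : realType) (I J : choiceType) (e : J -> I)
  (inje : injective e) (x : ell2 R I) j : ell2_sub inje x j = x (e j).
Proof. by []. Qed.

Lemma ell2_sub_linear (R : realType) (I J : choiceType) (e : J -> I)
  (inje : injective e) : linear (@ell2_sub R I J e inje).
Proof. by move=> c x y; apply/val_inj. Qed.

Lemma inl_inj (I J : Type) : injective (@inl I J). Proof. by move=> ? ? []. Qed.
Lemma inr_inj (I J : Type) : injective (@inr I J). Proof. by move=> ? ? []. Qed.
Lemma pairl_inj (I J : Type) (j : J) : injective (fun i : I => (i, j)).
Proof. by move=> ? ? []. Qed.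
Lemma pairr_inj (I J : Type) (i : I) : injective (fun j : J => (i, j)).
Proof. by move=> ? ? []. Qed.

Lemma ell2_basis_subproof (R : realType) (I : choiceType) (k : I) :
  (fun i => (i == k)%:R : R[i]^o) \in ell2_pred.
Proof.
rewrite inE /= /sqsum (esumID [set k]); last first.
  by move=> i _; rewrite lee_fin sqr_ge0.
rewrite !setTI esum_set1 ?lee_fin ?sqr_ge0// [X in (_ + X)%E]esum1 ?adde0 ?ltry//.
by move=> i /= /eqP/negbTE ->; rewrite nrm0 expr0n.
Qed.

Definition ell2_basis (R : realType) (I : choiceType) (k : I) : ell2 R I :=
  Ell2 (ell2_basis_subproof R k).

Section Bop.
Context {R : realType} {I : choiceType}.

Definition bop_pred : {pred ell2 R I -> ell2 R I} := mem [set f |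
  linear f /\ exists M : R, forall x, ell2_norm (f x) <= M * ell2_norm x].

Lemma sqsum_bounded (f : ell2 R I -> ell2 R I) (M : R) : 0 <= M ->
  (forall x, (sqsum (f x) <= M%:E * sqsum x)%E) ->
  exists M : R, forall x, ell2_norm (f x) <= M * ell2_norm x.
Proof.
move=> M0 fM; exists (Num.sqrt M) => x.
rewrite -ler_sqr ?nnegrE ?mulr_ge0 ?sqrtr_ge0//.
rewrite exprMn (sqr_sqrtr M0)// -lee_fin.
by have := fM x; rewrite !sqsumE -EFinM.
Qed.

Lemma bounded_sqsum (f : ell2 R I -> ell2 R I) (M : R) :
  (forall x, ell2_norm (f x) <= M * ell2_norm x) ->
  forall x, (sqsum (f x) <= (M ^+ 2)%:E * sqsum x)%E.
Proof.
move=> fM x; rewrite !sqsumE -EFinM lee_fin -exprMn.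
by rewrite lerXn2r ?nnegrE ?(le_trans _ (fM x)) ?ell2_norm_ge0.
Qed.

Lemma bop_submod_closed : submod_closed bop_pred.
Proof.
split=> [|c f g].
  rewrite inE /=; split=> [d x y|].
    have zE z : (0 : ell2 R I -> ell2 R I) z = 0 by [].
    by rewrite !zE scaler0 addr0.
  apply: (@sqsum_bounded 0 0 (lexx _)) => x.
  by rewrite mul0e [leLHS]sqsum0.
rewrite !inE /= => -[lf [M fM]] [lg [N gN]]; split=> [d x y|].
  rewrite !fctE /= lf lg !scalerDr !scalerA addrACA.
  by rewrite [(c * d)%R]mulrC.
apply: (@sqsum_bounded (c *: f + g) (2 * (nrm c ^+ 2 * M ^+ 2 + N ^+ 2))).
  apply: mulr_ge0 => //; apply: addr_ge0; last exact: sqr_ge0.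
  by apply: mulr_ge0; exact: sqr_ge0.
move=> x; apply: le_trans (sqsumD _ _) _.
rewrite EFinM -muleA lee_wpmul2l ?lee_fin//.
rewrite EFinD ge0_muleDl ?lee_fin ?(mulr_ge0 (sqr_ge0 _) (sqr_ge0 _)) ?sqr_ge0//.
rewrite leeD ?bounded_sqsum//.
apply: le_trans (sqsumZ _ _) _.
by rewrite [(_ * M ^+ 2)%:E]EFinM -muleA lee_wpmul2l ?lee_fin ?sqr_ge0// bounded_sqsum.
Qed.

HB.instance Definition _ :=
  GRing.isSubmodClosed.Build R[i] (ell2 R I -> ell2 R I) bop_pred bop_submod_closed.

End Bop.

Record bop (R : realType) (I : choiceType) :=
  Bop { bop_val :> ell2 R I -> ell2 R I; _ : bop_val \in bop_pred }.

Section BopSpace.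
Context {R : realType} {I : choiceType}.

HB.instance Definition _ := [isSub for @bop_val R I].
HB.instance Definition _ := [Choice of bop R I by <:].
HB.instance Definition _ := [SubChoice_isSubLmodule of bop R I by <:].

Lemma bop_linear (A : bop R I) : linear A.
Proof. by case: A => A /=; rewrite inE => -[]. Qed.

HB.instance Definition _ (A : bop R I) :=
  GRing.isLinear.Build R[i] (ell2 R I) (ell2 R I) _ A (bop_linear A).

Lemma bop_bounded (A : bop R I) :
  exists M : R, forall x, ell2_norm (A x) <= M * ell2_norm x.
Proof. by case: A => A /=; rewrite inE => -[]. Qed.

Lemma bop_sqsum (A : bop R I) : exists M : R, 0 <= M /\
  forall x, (sqsum (A x) <= M%:E * sqsum x)%E.
Proof.
have [M AM] := bop_bounded A.
by exists (M ^+ 2); split; [exact: sqr_ge0|exact: bounded_sqsum].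
Qed.

End BopSpace.

Lemma bop_intro (R : realType) (I : choiceType) (f : ell2 R I -> ell2 R I) (M : R) :
  linear f -> 0 <= M -> (forall x, (sqsum (f x) <= M%:E * sqsum x)%E) ->
  f \in bop_pred.
Proof. by move=> lf M0 fM; rewrite inE; split=> //; exact: sqsum_bounded fM. Qed.

Section Algebra.
Context {R : realType} {I : choiceType}.

Lemma bop_id_subproof : (@id (ell2 R I)) \in bop_pred.
Proof. by apply: (@bop_intro _ _ _ 1) => // x; rewrite mul1e. Qed.

Definition bop_id : bop R I := Bop bop_id_subproof.

Lemma bop_comp_subproof (A B : bop R I) : (A \o B) \in bop_pred.
Proof.
have [M [M0 AM]] := bop_sqsum A; have [N [N0 BN]] := bop_sqsum B.
apply: (@bop_intro _ _ _ (M * N)) => [c x y||x]; rewrite ?mulr_ge0//=.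
  by rewrite !linearP.
by apply: le_trans (AM _) _; rewrite EFinM -muleA lee_wpmul2l ?lee_fin.
Qed.

Definition bop_comp (A B : bop R I) : bop R I := Bop (bop_comp_subproof A B).

End Algebra.

Section MatrixOperator.
Context {R : realType} {n : nat} (A : 'M[R[i]]_n).

Definition mxop_fun (x : 'I_n -> R[i]) : 'I_n -> R[i]^o :=
  fun i => \sum_j A i j * x j.

Lemma sqsum_ord (x : 'I_n -> R[i]) : sqsum x = (\sum_i nrm (x i) ^+ 2)%:E.
Proof.
rewrite /sqsum esum_fset; last by move=> i _; rewrite lee_fin sqr_ge0.
  rewrite (fsbigE (index_enum 'I_n)) ?index_enum_uniq//; last first.
    by move=> i _; rewrite mem_index_enum.
  by rewrite -sumEFin; apply: eq_bigl => i; rewrite in_setT.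
exact: finite_finset.
Qed.

Lemma mxop_fun_ell2 (x : ell2 R 'I_n) : mxop_fun x \in ell2_pred.
Proof. by rewrite inE /= sqsum_ord ltry. Qed.

Lemma mxop_subproof : (fun x => Ell2 (mxop_fun_ell2 x)) \in bop_pred.
Proof.
pose M := \sum_i (\sum_j nrm (A i j)) ^+ 2.
apply: (@bop_intro _ _ _ M) => [c x y||x].
- apply/val_inj/funext => i /=; rewrite /mxop_fun !fctE /= scaler_sumr -big_split.
  by apply: eq_bigr => j _; rewrite mulrDr mulrCA.
- by apply: sumr_ge0 => i _; exact: sqr_ge0.
rewrite sqsum_ord sqsumE -EFinM lee_fin mulr_suml ler_sum// => i _.
have A0 : 0 <= \sum_j nrm (A i j) by apply: sumr_ge0 => j _; exact: nrm_ge0.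
rewrite -exprMn lerXn2r ?nnegrE ?nrm_ge0// ?mulr_ge0 ?ell2_norm_ge0//.
apply: le_trans (ler_nrm_sum _) _; rewrite mulr_suml ler_sum// => j _.
by rewrite nrmM ler_wpM2l ?nrm_ge0// ell2_coord.
Qed.

Definition mxop : bop R 'I_n := Bop mxop_subproof.

End MatrixOperator.

Section DirectSum.
Context {R : realType} {I J : choiceType} (A : bop R I) (B : bop R J).

Definition dsum_fun (x : ell2 R (I + J)%type) : I + J -> R[i]^o := fun k =>
  match k with
  | inl i => A (ell2_sub (@inl_inj I J) x) i
  | inr j => B (ell2_sub (@inr_inj I J) x) j
  end.

Lemma sqsum_sumtype (x : I + J -> R[i]) :
  sqsum x = (sqsum (x \o inl) + sqsum (x \o inr))%E.
Proof. by rewrite /sqsum esum_sumtype// => k; rewrite lee_fin sqr_ge0. Qed.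

Lemma dsum_fun_ell2 x : dsum_fun x \in ell2_pred.
Proof.
rewrite inE /= sqsum_sumtype.
rewrite [X in (X + _)%E](_ : _ = sqsum (A (ell2_sub (@inl_inj I J) x)))//.
rewrite [X in (_ + X)%E](_ : _ = sqsum (B (ell2_sub (@inr_inj I J) x)))//.
by rewrite !sqsumE -EFinD ltry.
Qed.

Lemma dsum_subproof : (fun x => Ell2 (dsum_fun_ell2 x)) \in bop_pred.
Proof.
have [M [M0 AM]] := bop_sqsum A; have [N [N0 BN]] := bop_sqsum B.
apply: (@bop_intro _ _ _ (M + N)) => [c x y||x]; rewrite ?addr_ge0//.
  by apply/val_inj/funext => -[i|j] /=; rewrite ell2_sub_linear linearP.
rewrite !sqsum_sumtype ge0_muleDr ?sqsum_ge0//.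
apply: leeD.
- apply: le_trans (AM (ell2_sub (@inl_inj I J) x)) _.
  by rewrite lee_wpmul2r ?sqsum_ge0// lee_fin lerDl.
- apply: le_trans (BN (ell2_sub (@inr_inj I J) x)) _.
  by rewrite lee_wpmul2r ?sqsum_ge0// lee_fin lerDr.
Qed.

(* A (+) B on l^2(I) (+) l^2(J), which is realised as l^2(I + J). *)
Definition dsum : bop R (I + J)%type := Bop dsum_subproof.

End DirectSum.

Section Tensor.
Context {R : realType} {I J : choiceType}.

Lemma sqsum_prodtype (x : I * J -> R[i]) :
  sqsum x = \esum_(i in [set: I]) sqsum (fun j => x (i, j)).
Proof. by rewrite /sqsum esum_prodtype// => k; rewrite lee_fin sqr_ge0. Qed.

Lemma sqsum_prodtypeC (x : I * J -> R[i]) :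
  sqsum x = \esum_(j in [set: J]) sqsum (fun i => x (i, j)).
Proof. by rewrite /sqsum esum_prodtypeC// => k; rewrite lee_fin sqr_ge0. Qed.

Definition ampl_fun (A : bop R I) (x : ell2 R (I * J)%type) : I * J -> R[i]^o :=
  fun k => A (ell2_sub (@pairl_inj I J k.2) x) k.1.

Definition ampr_fun (B : bop R J) (x : ell2 R (I * J)%type) : I * J -> R[i]^o :=
  fun k => B (ell2_sub (@pairr_inj I J k.1) x) k.2.

Lemma ampl_fun_sqsum (A : bop R I) M x : 0 <= M ->
  (forall y, (sqsum (A y) <= M%:E * sqsum y)%E) ->
  (sqsum (ampl_fun A x) <= M%:E * sqsum x)%E.
Proof.
move=> M0 AM; rewrite !sqsum_prodtypeC.
apply: le_trans (esumZ M0 _) => [|j]; last exact: sqsum_ge0.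
by apply: le_esum => j _; exact: (AM (ell2_sub (@pairl_inj I J j) x)).
Qed.

Lemma ampr_fun_sqsum (B : bop R J) M x : 0 <= M ->
  (forall y, (sqsum (B y) <= M%:E * sqsum y)%E) ->
  (sqsum (ampr_fun B x) <= M%:E * sqsum x)%E.
Proof.
move=> M0 BM; rewrite !sqsum_prodtype.
apply: le_trans (esumZ M0 _) => [|i]; last exact: sqsum_ge0.
by apply: le_esum => i _; exact: (BM (ell2_sub (@pairr_inj I J i) x)).
Qed.

Lemma ampl_fun_ell2 A x : ampl_fun A x \in ell2_pred.
Proof.
have [M [M0 AM]] := bop_sqsum A; rewrite inE /=.
by apply: le_lt_trans (ampl_fun_sqsum _ M0 AM) _; rewrite sqsumE -EFinM ltry.
Qed.

Lemma ampr_fun_ell2 B x : ampr_fun B x \in ell2_pred.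
Proof.
have [M [M0 BM]] := bop_sqsum B; rewrite inE /=.
by apply: le_lt_trans (ampr_fun_sqsum _ M0 BM) _; rewrite sqsumE -EFinM ltry.
Qed.

Lemma ampl_subproof A : (fun x => Ell2 (ampl_fun_ell2 A x)) \in bop_pred.
Proof.
have [M [M0 AM]] := bop_sqsum A.
apply: (@bop_intro _ _ _ M) => // [c x y|x]; last exact: ampl_fun_sqsum.
by apply/val_inj/funext => k /=; rewrite /ampl_fun ell2_sub_linear linearP.
Qed.

Lemma ampr_subproof B : (fun x => Ell2 (ampr_fun_ell2 B x)) \in bop_pred.
Proof.
have [M [M0 BM]] := bop_sqsum B.
apply: (@bop_intro _ _ _ M) => // [c x y|x]; last exact: ampr_fun_sqsum.
by apply/val_inj/funext => k /=; rewrite /ampr_fun ell2_sub_linear linearP.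
Qed.

(* l^2(I * J) realises the Hilbert space tensor product of l^2(I) and l^2(J): the
   elementary tensor x (x) y is the family (i, j) |-> x i * y j, and the tensors
   e_i (x) e_j of basis vectors form the standard basis (tensv_basis). *)
Lemma tensv_subproof (x : ell2 R I) (y : ell2 R J) :
  (fun k => x k.1 * y k.2 : R[i]^o) \in ell2_pred.
Proof.
rewrite inE /= sqsum_prodtype; apply: (@le_lt_trans _ _
  (\esum_(i in [set: I]) ((ell2_norm y ^+ 2)%:E * (nrm (x i) ^+ 2)%:E))%E).
  apply: le_esum => i _; apply: le_trans (sqsumZ (x i) y) _.
  by rewrite sqsumE muleC.
apply: le_lt_trans (esumZ _ _) _.
- exact: sqr_ge0.
- by move=> i; rewrite lee_fin sqr_ge0.
- by rewrite [X in (_ * X)%E]sqsumE -EFinM ltry.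
Qed.

Definition tensv (x : ell2 R I) (y : ell2 R J) : ell2 R (I * J)%type :=
  Ell2 (tensv_subproof x y).

Lemma tensv_basis i j :
  tensv (ell2_basis R i) (ell2_basis R j) = ell2_basis R (i, j).
Proof.
by apply/val_inj/funext => -[k l] /=; rewrite xpair_eqE -natrM mulnb.
Qed.

(* A (x) B = (A (x) 1)(1 (x) B), where A (x) 1 acts on the first coordinate and
   1 (x) B on the second one; see tensE. *)
Definition tens (A : bop R I) (B : bop R J) : bop R (I * J)%type :=
  bop_comp (Bop (ampl_subproof A)) (Bop (ampr_subproof B)).

Lemma tensE A B x y : tens A B (tensv x y) = tensv (A x) (B y).
Proof.
have tensvl x' j : ell2_sub (@pairl_inj I J j) (tensv x' (B y)) = B y j *: x'.
  by apply/val_inj/funext => i /=; rewrite mulrC.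
have tensvr i : ell2_sub (@pairr_inj I J i) (tensv x y) = x i *: y.
  by apply/val_inj/funext => j.
have -> : tens A B (tensv x y) = Bop (ampl_subproof A) (tensv x (B y)).
  change (Bop (ampl_subproof A) (Bop (ampr_subproof B) (tensv x y)) =
          Bop (ampl_subproof A) (tensv x (B y))).
  congr (bop_val _ _); apply/val_inj/funext => k /=.
  by rewrite /ampr_fun tensvr linearZ.
apply/val_inj/funext => k /=.
by rewrite /ampl_fun tensvl linearZ /= mulrC.
Qed.

End Tensor.

Section OperatorNorm.
Context {R : realType}.

(* The norm of f : (V, p) -> (W, q); it is +oo when f is unbounded. *)
Definition opnorm (V W : Type) (p : V -> R) (q : W -> R) (f : V -> W) : \bar R :=
  ereal_sup [set (q (f x))%:E | x in [set x | p x <= 1]].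

Definition bop_norm (I : choiceType) (A : bop R I) : \bar R :=
  opnorm (@ell2_norm R I) (@ell2_norm R I) A.

Definition mxop_norm (k : nat) (A : 'M[R[i]]_k) : \bar R := bop_norm (mxop A).

End OperatorNorm.

Section Spectrum.
Context {R : realType} {I : choiceType}.

Definition bop_invertible (A : bop R I) :=
  exists B : bop R I, bop_comp A B = bop_id /\ bop_comp B A = bop_id.

Definition spectrum (A : bop R I) : set R[i] :=
  [set l | ~ bop_invertible (A - l *: bop_id)].

Definition diagonal_bop (A : bop R I) :=
  forall k, exists c : R[i], A (ell2_basis R k) = c *: ell2_basis R k.

Definition unit_circle : set R[i] := [set l | `|l| = 1].

End Spectrum.

(* A vector space with a sequence of (matricial) norms; only the values at
   k >= 1 are significant. *)
Record opspace (R : realType) := OpSpace {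
  os_sort :> lmodType R[i];
  os_norm : forall k : nat, 'M[os_sort]_k -> \bar R }.

Definition completely_isometric (R : realType) (W W' : opspace R) :=
  exists T : {linear W -> W'}, bijective T /\
    forall k, (0 < k)%N -> forall w : 'M[W]_k, os_norm (map_mx T w) = os_norm w.

Section OperatorSpaces.
Context {R : realType} (W : normedModType R[i]).

Definition isometric_to_bop (I : choiceType) (phi : W -> bop R I) :=
  forall w, bop_norm (phi w) = (nrm w)%:E.

(* The norm of H (+) ... (+) H (k copies), where H = ell2 R I. *)
Definition copies_norm (I : choiceType) (k : nat) (h : 'I_k -> ell2 R I) : R :=
  Num.sqrt (\sum_i ell2_norm (h i) ^+ 2).

Definition bop_mx_norm (I : choiceType) (k : nat) (A : 'M[bop R I]_k) : \bar R :=
  opnorm (@copies_norm I k) (@copies_norm I k)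
    (fun h i => \sum_j A i j (h j)).

Definition induced_opspace (I : choiceType) (phi : {linear W -> bop R I}) : opspace R :=
  @OpSpace R W (fun k w => bop_mx_norm (map_mx phi w)).

Definition dual_ball : set {linear W -> R[i]^o} :=
  [set f | (opnorm (@nrm R W) (@nrm R R[i]) f <= 1)%E].

Definition MIN : opspace R :=
  @OpSpace R W (fun k w =>
    ereal_sup [set mxop_norm (map_mx f w : 'M[R[i]]_k) | f in dual_ball]).

End OperatorSpaces.

Section Construction.
Context {R : realType}.

Definition mx2 (a b c d : R) : 'M[R[i]]_2 :=
  \matrix_(i, j) (if i == 0 then if j == 0 then a else b
                  else if j == 0 then c else d)%:C%C.

Definition matI2 : 'M[R[i]]_2 := 1%:M.
Definition matU := mx2 (1 / 2) (Num.sqrt 3 / 2) (Num.sqrt 3 / 2) (- (1 / 2)).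
Definition matV := mx2 (1 / 2) (- (Num.sqrt 3 / 2)) (Num.sqrt 3 / 2) (1 / 2).

(* L = C^2 (+) l^2(Z). *)
Definition Lidx : choiceType := ('I_2 + int)%type.
(* K = (L (x) L (x) L) (+) C^2. *)
Definition Kidx : choiceType := (Lidx * Lidx * Lidx + 'I_2)%type.

Context (D : bop R int).

Definition Ttilde (M : 'M[R[i]]_2) : bop R Lidx := dsum (mxop M) D.

Definition That1 : bop R (Lidx * Lidx * Lidx)%type :=
  tens (tens (Ttilde matI2) bop_id) bop_id.
Definition That2 : bop R (Lidx * Lidx * Lidx)%type :=
  tens (tens bop_id (Ttilde matU)) bop_id.
Definition That3 : bop R (Lidx * Lidx * Lidx)%type :=
  tens (tens bop_id bop_id) (Ttilde matV).

Definition S1 : bop R Kidx := dsum That1 (mxop matI2).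
Definition S2 : bop R Kidx := dsum That2 (mxop matU).
Definition S3 : bop R Kidx := dsum That3 (mxop matV).

Definition Smap (z : ell1 R 3) : bop R Kidx :=
  z 0 0 *: S1 + z 0 1 *: S2 + z 0 ord_max *: S3.

Lemma Smap_linear : linear Smap.
Proof.
move=> c x y; rewrite /Smap !mxE !scalerDl -!scalerA !scalerDr.
by rewrite [RHS]addrACA [X in _ = X + _]addrACA.
Qed.

HB.instance Definition _ :=
  GRing.isLinear.Build R[i] (ell1 R 3) (bop R Kidx) _ Smap Smap_linear.

End Construction.

(* Main.v *)
Require Import Defs.
From HB Require Import structures.
From mathcomp Require Import all_boot all_order all_algebra.
From mathcomp Require Import finmap complex ring lra.
From mathcomp Require Import all_classical all_reals all_analysis.
Set Implicit Arguments.
Unset Strict Implicit.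
Unset Printing Implicit Defensive.
Import Order.TTheory GRing.Theory Num.Theory.
Import numFieldNormedType.Exports.
Local Open Scope classical_set_scope.
Local Open Scope ring_scope.

(** S is an isometry ([Smap_isometric]). The operators S_1, S_2, S_3 are contractions,
    so ||S(z)|| <= |z_1| + |z_2| + |z_3| ([Smap_bounded]). Conversely D acts
    coordinatewise ([diagonal_bopE]), so every point of its spectrum, in particular
    every unimodular number, is approximated by diagonal entries of D
    ([spectrum_diagonal_approx]). Since D occurs in three different tensor legs,
    there are joint eigenvectors of S_1, S_2, S_3 whose eigenvalues approximate any
    three given unimodular numbers ([Smap_eigenbasis]); choosing these to cancel the
    phases of the z_i gives the reverse inequality.

    The induced structure is not MIN ([Smap_not_MIN]). The two structures are compared
    on the pencil w = I_2 (x) e_1 + U (x) e_2 + V (x) e_3 in M_2(l^1(3)). The summand C^2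
    of K gives ||w||_S >= ||I (x) I + U (x) U + V (x) V|| >= 3, attained at the vector
    e_0 (x) e_0 + e_1 (x) e_1, which Q (x) Q fixes for every real orthogonal Q
    ([pencil_induced]). On the other hand ||w||_MIN is the supremum of
    ||a I + b U + c V|| over |a|, |b|, |c| <= 1, and already the Hilbert-Schmidt norm of
    these matrices is at most sqrt 8 < 3 ([pencil_MIN]). A complete isometry T onto
    MIN(l^1(3)) would be contractive for the norm of l^1(3), as both structures have
    that norm at k = 1. Composing functionals with T then gives
    ||w||_S = ||T w||_MIN <= sqrt 8, a contradiction. *)

(** * The norm of l^2(I) *)

Section Norms.
Context {R : realType}.

Lemma nrm_sq (c : R[i]) : nrm c ^+ 2 = complex.Re c ^+ 2 + complex.Im c ^+ 2.
Proof.
case: c => a b; rewrite /nrm normc_def /= sqr_sqrtr //.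
by rewrite addr_ge0 ?sqr_ge0.
Qed.

Lemma nrm_real (a : R) : nrm (a%:C%C : R[i]) = `|a|.
Proof. by rewrite /nrm normc_def /= expr0n addr0 sqrtr_sqr. Qed.

Context {I : choiceType}.

(** Pointwise this is |a + b|^2 <= (1 + t) |a|^2 + (1 + 1/t) |b|^2. For
    t = ||y|| / ||x|| the right-hand side is (||x|| + ||y||)^2, which
    gives the triangle inequality. *)
Lemma sqsumD_weighted (t : R) (x y : I -> R[i]) : 0 < t ->
  (sqsum (fun i => x i + y i)%R <=
   (1 + t)%:E * sqsum x + (1 + t^-1)%:E * sqsum y)%E.
Proof.
move=> t0; have t'0 : 0 < t^-1 by rewrite invr_gt0.
apply: (@le_trans _ _ (\esum_(i in [set: I])
  (((1 + t)%:E * (nrm (x i) ^+ 2)%:E) + ((1 + t^-1)%:E * (nrm (y i) ^+ 2)%:E))%E)).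
  apply: le_esum => i _; rewrite -!EFinM -EFinD lee_fin.
  apply: (@le_trans _ _ ((nrm (x i) + nrm (y i)) ^+ 2)).
    by rewrite lerXn2r ?nnegrE ?addr_ge0 ?nrm_ge0 ?ler_nrmD.
  rewrite -subr_ge0.
  rewrite (_ : _ - _ = t * (nrm (x i) - t^-1 * nrm (y i)) ^+ 2).
    by rewrite mulr_ge0 ?sqr_ge0 ?ltW.
  by field; rewrite gt_eqF.
rewrite esumD; [|by move=> i _; rewrite -EFinM lee_fin mulr_ge0 ?sqr_ge0 ?addr_ge0 ?ltW..].
by apply: leeD; apply: esumZ => [|i]; rewrite ?lee_fin ?sqr_ge0 ?addr_ge0 ?ltW.
Qed.

Lemma ell2_norm_eq0 (x : ell2 R I) : ell2_norm x = 0 -> x = 0.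
Proof.
move=> x0; apply/val_inj/funext => i; apply: nrm_eq0.
by apply/eqP; rewrite eq_le nrm_ge0 andbT -x0; exact: ell2_coord.
Qed.

Lemma ell2_norm0 : ell2_norm (0 : ell2 R I) = 0.
Proof. by rewrite /ell2_norm [sqsum _]sqsum0 /= sqrtr0. Qed.

Lemma ler_ell2_normD (x y : ell2 R I) :
  ell2_norm (x + y) <= ell2_norm x + ell2_norm y.
Proof.
have [/ell2_norm_eq0 ->|x0] := eqVneq (ell2_norm x) 0.
  by rewrite ell2_norm0 !add0r.
have [/ell2_norm_eq0 ->|y0] := eqVneq (ell2_norm y) 0.
  by rewrite ell2_norm0 !addr0.
have xp : 0 < ell2_norm x by rewrite lt_def x0 ell2_norm_ge0.
have yp : 0 < ell2_norm y by rewrite lt_def y0 ell2_norm_ge0.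
rewrite -ler_sqr ?nnegrE ?addr_ge0 ?ell2_norm_ge0// -lee_fin -sqsumE.
have xyE : sqsum (x + y : ell2 R I) = sqsum (fun i => x i + y i) by [].
rewrite xyE; apply: le_trans (sqsumD_weighted x y (divr_gt0 yp xp)) _.
rewrite !sqsumE -!EFinM -EFinD lee_fin le_eqVlt; apply/orP; left; apply/eqP.
by field; rewrite x0 y0.
Qed.

Lemma ell2_normZ_le (c : R[i]) (x : ell2 R I) :
  ell2_norm (c *: x) <= nrm c * ell2_norm x.
Proof.
rewrite -ler_sqr ?nnegrE ?mulr_ge0 ?nrm_ge0 ?ell2_norm_ge0//.
rewrite -lee_fin exprMn [leRHS]EFinM -!sqsumE; exact: (sqsumZ c x).
Qed.

Lemma ell2_norm_basis (k : I) : ell2_norm (ell2_basis R k) = 1.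
Proof.
apply/eqP; rewrite eq_le; apply/andP; split; last first.
  have := ell2_coord (ell2_basis R k) k.
  by rewrite /= eqxx (_ : nrm _ = 1)// (_ : true%:R = 1%:C%C)// nrm_real normr1.
rewrite -ler_sqr ?nnegrE ?ell2_norm_ge0// -lee_fin -sqsumE.
rewrite /sqsum (esumID [set k]); last by move=> i _; rewrite lee_fin sqr_ge0.
rewrite !setTI esum_set1 ?lee_fin ?sqr_ge0// [X in (_ + X)%E]esum1 ?adde0.
  by rewrite /= eqxx lee_fin (_ : true%:R = 1%:C%C)// nrm_real normr1.
by move=> i /= /eqP/negbTE ->; rewrite nrm0 expr0n.
Qed.

End Norms.

(** * Contractions *)

Section Contractions.
Context {R : realType}.

Definition contractive_op (I : choiceType) (A : bop R I) :=
  forall x, ell2_norm (A x) <= ell2_norm x.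

Lemma contractive_opP (I : choiceType) (A : bop R I) :
  contractive_op A <-> forall x, (sqsum (A x) <= 1%:E * sqsum x)%E.
Proof.
by split=> cA x; move: (cA x);
  rewrite mul1e !sqsumE lee_fin ler_sqr ?nnegrE ?ell2_norm_ge0.
Qed.

Lemma bop_norm_contractive_op (I : choiceType) (A : bop R I) :
  (bop_norm A <= 1%:E)%E -> contractive_op A.
Proof.
move=> A1 x; have [/ell2_norm_eq0 ->|x0] := eqVneq (ell2_norm x) 0.
  by rewrite linear0.
have xp : 0 < ell2_norm x by rewrite lt_def x0 ell2_norm_ge0.
pose r := ell2_norm x.
have rx : x = r%:C%C *: ((r^-1)%:C%C *: x).
  by rewrite scalerA -rmorphM/= divff// scale1r.
have A2 : ell2_norm (A ((r^-1)%:C%C *: x)) <= 1.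
  rewrite -lee_fin; apply: le_trans A1; apply: ereal_sup_ubound.
  exists ((r^-1)%:C%C *: x) => //=; apply: le_trans (ell2_normZ_le _ _) _.
  by rewrite nrm_real gtr0_norm ?invr_gt0// mulVf.
rewrite {1}rx linearZ/=; apply: le_trans (ell2_normZ_le _ _) _.
by rewrite nrm_real gtr0_norm// ler_piMr// ltW.
Qed.

Lemma contractive_dsum (I J : choiceType) (A : bop R I) (B : bop R J) :
  contractive_op A -> contractive_op B -> contractive_op (dsum A B).
Proof.
move=> /contractive_opP cA /contractive_opP cB; apply/contractive_opP => x.
rewrite !sqsum_sumtype mul1e; apply: leeD.
- by apply: (le_trans (cA (ell2_sub (@Defs.inl_inj I J) x))); rewrite mul1e.
- by apply: (le_trans (cB (ell2_sub (@Defs.inr_inj I J) x))); rewrite mul1e.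
Qed.

Lemma contractive_tens (I J : choiceType) (A : bop R I) (B : bop R J) :
  contractive_op A -> contractive_op B -> contractive_op (tens A B).
Proof.
move=> /contractive_opP cA /contractive_opP cB x.
have cl : contractive_op (Bop (@ampl_subproof R I J A)).
  by apply/contractive_opP => y; exact: (ampl_fun_sqsum y ler01 cA).
have cr : contractive_op (Bop (@ampr_subproof R I J B)).
  by apply/contractive_opP => y; exact: (ampr_fun_sqsum y ler01 cB).
exact: le_trans (cl _) (cr x).
Qed.

Lemma contractive_id (I : choiceType) : contractive_op (@bop_id R I).
Proof. by move=> x; exact: lexx. Qed.

(** The hypotheses say that the matrix is orthogonal. Being real, it acts separately
    on the real and the imaginary part of a vector and preserves the norm of each. *)
Lemma contractive_mx2 (a b c d : R) :
  a ^+ 2 + c ^+ 2 = 1 -> b ^+ 2 + d ^+ 2 = 1 -> a * b + c * d = 0 ->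
  contractive_op (mxop (mx2 a b c d)).
Proof.
move=> H1 H2 H3; apply/contractive_opP => x.
rewrite mul1e !sqsum_ord lee_fin /= /mxop_fun !big_ord_recl !big_ord0 !mxE /=.
case: (x ord0) => p q; case: (x (lift ord0 ord0)) => r s; rewrite !nrm_sq /=.
rewrite !mul0r !subr0 !addr0.
rewrite (_ : _ + _ = (a ^+ 2 + c ^+ 2) * (p ^+ 2 + q ^+ 2) +
  (b ^+ 2 + d ^+ 2) * (r ^+ 2 + s ^+ 2) +
  2 * (a * b + c * d) * (p * r + q * s)); last by ring.
by rewrite H1 H2 H3 !mul1r mulr0 mul0r addr0.
Qed.

End Contractions.

(** * Diagonal operators and their spectrum *)

Section Multiplier.
Context {R : realType} {I : choiceType}.

Lemma multiplier_sqsum (m : I -> R[i]) (C : R) (x : I -> R[i]) :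
  (forall i, nrm (m i) <= C) ->
  (sqsum (fun i => m i * x i)%R <= (C ^+ 2)%:E * sqsum x)%E.
Proof.
move=> mC; apply: le_trans (esumZ _ _); rewrite ?sqr_ge0//; last first.
  by move=> i; rewrite lee_fin sqr_ge0.
apply: le_esum => i _; rewrite -EFinM lee_fin nrmM exprMn ler_wpM2r ?sqr_ge0//.
by rewrite lerXn2r ?nnegrE ?nrm_ge0// (le_trans (nrm_ge0 _) (mC i)).
Qed.

Lemma multiplier_subproof (m : I -> R[i]) (C : R) (mC : forall i, nrm (m i) <= C)
  (x : ell2 R I) : (fun i => m i * x i : R[i]^o) \in ell2_pred.
Proof.
rewrite inE /=; apply: le_lt_trans (multiplier_sqsum x mC) _.
by rewrite sqsumE -EFinM ltry.
Qed.

Definition multiplier_fun m C mC (x : ell2 R I) : ell2 R I :=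
  Ell2 (@multiplier_subproof m C mC x).

Lemma multiplier_bop m C mC : (@multiplier_fun m C mC) \in bop_pred.
Proof.
apply: (@bop_intro _ _ _ (C ^+ 2)) => [c x y||x]; rewrite ?sqr_ge0//.
  by apply/val_inj/funext => i /=; rewrite !fctE /= mulrDr mulrCA.
exact: multiplier_sqsum.
Qed.

Definition multiplier m C mC : bop R I := Bop (@multiplier_bop m C mC).

Lemma ell2_scale_basis (c : R[i]) (i k : I) :
  (c *: ell2_basis R i) k = c * (k == i)%:R.
Proof. by []. Qed.

Lemma ell2_sum_coord (J : Type) (s : seq J) (F : J -> ell2 R I) (k : I) :
  (\sum_(i <- s) F i) k = \sum_(i <- s) (F i k : R[i]).
Proof. by elim/big_rec2: _ => [//|i y x _ <-]. Qed.

Definition truncation (x : ell2 R I) (s : seq I) : ell2 R I :=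
  \sum_(i <- s) x i *: ell2_basis R i.

Lemma truncationE x s k : uniq s ->
  truncation x s k = if k \in s then x k else 0.
Proof.
move=> us; rewrite ell2_sum_coord; case: ifPn => ks.
  rewrite (bigD1_seq k ks us) ell2_scale_basis eqxx mulr1 big1.
    exact: addr0.
  by move=> i ik; rewrite ell2_scale_basis eq_sym (negbTE ik) mulr0.
rewrite big_seq big1// => i is_; rewrite ell2_scale_basis (_ : k == i = false) ?mulr0//.
by apply/eqP => ki; rewrite ki is_ in ks.
Qed.

(** The square sum is a supremum of finite partial sums, and the truncation to a
    finite set X leaves exactly the part of the square sum outside X. *)
Lemma truncation_approx (x : ell2 R I) (e : R) : 0 < e ->
  exists2 s, uniq s & ell2_norm (x - truncation x s) <= e.
Proof.
move=> e0; have e20 : 0 < e ^+ 2 by rewrite exprn_gt0.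
have xfin : (sqsum x \is a fin_num)%E by rewrite sqsumE.
have [_ [X [finX _] <-] Xe] := ub_ereal_sup_adherent e20 xfin.
exists (fset_set X); first exact: fset_uniq.
have a0 i : (0 <= (nrm (x i) ^+ 2)%:E)%E by rewrite lee_fin sqr_ge0.
rewrite -ler_sqr ?nnegrE ?ell2_norm_ge0 ?(ltW e0)// -lee_fin -sqsumE.
have tailE : sqsum (x - truncation x (fset_set X)) =
    (\esum_(i in ~` X) (nrm (x i) ^+ 2)%:E)%E.
  have dE i : (x - truncation x (fset_set X)) i = if i \in X then 0 else x i.
    have -> : (x - truncation x (fset_set X)) i = x i - truncation x (fset_set X) i.
      by [].
    rewrite truncationE ?fset_uniq// in_fset_set//.
    by case: ifP => _; rewrite ?subrr ?subr0.
  rewrite /sqsum (esumID X); last by move=> i _; rewrite lee_fin sqr_ge0.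
  rewrite !setTI esum1 ?add0e; last first.
    by move=> i Xi; rewrite dE mem_set// nrm0 expr0n.
  by apply: eq_esum => i Xi; rewrite dE memNset.
have : sqsum x = (\sum_(i \in X) (nrm (x i) ^+ 2)%:E +
    \esum_(i in ~` X) (nrm (x i) ^+ 2)%:E)%E.
  by rewrite /sqsum (esumID X)// !setTI esum_fset.
rewrite tailE => sE; move: Xe; rewrite -[ereal_sup _]/(sqsum x) sE.
have : (\sum_(i \in X) (nrm (x i) ^+ 2)%:E \is a fin_num)%E.
  by rewrite fsbig_finite//= sumEFin.
have : (\esum_(i in ~` X) (nrm (x i) ^+ 2)%:E \is a fin_num)%E.
  rewrite ge0_fin_numE ?esum_ge0//; apply: (@le_lt_trans _ _ (sqsum x)).
    by rewrite sE leeDr// fsume_ge0.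
  by rewrite sqsumE ltry.
move=> /fineK <- /fineK <-; rewrite -!EFinD lte_fin lee_fin.
by lra.
Qed.

Lemma bop_ext (A B : bop R I) : (forall x k, A x k = B x k) -> A = B.
Proof. by move=> AB; apply/val_inj/funext => x; apply/val_inj/funext => k; exact: AB. Qed.

Lemma bop_compE (A B : bop R I) x : bop_comp A B x = A (B x).
Proof. by []. Qed.

Lemma bop_idE x : @bop_id R I x = x.
Proof. by []. Qed.

Lemma multiplierE m C mC x k : @multiplier m C mC x k = m k * x k.
Proof. by []. Qed.

Lemma bop_coord_bounded (A : bop R I) : exists2 M : R, 0 < M &
  forall x k, nrm (A x k) <= M * ell2_norm x.
Proof.
have [M AM] := bop_bounded A; exists (`|M| + 1); first by rewrite ltr_wpDl.
move=> x k; apply: le_trans (ell2_coord _ _) _; apply: le_trans (AM x) _.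
by rewrite ler_wpM2r ?ell2_norm_ge0// (le_trans (ler_norm _))// lerDl.
Qed.

(** Linearity gives the formula on finitely supported vectors only. Both sides are
    continuous in x (|d k| <= M because d k is an entry of D), so it extends to
    all of l^2 through the truncations of x. *)
Lemma diagonal_bopE (D : bop R I) (d : I -> R[i]) :
  (forall k, D (ell2_basis R k) = d k *: ell2_basis R k) ->
  forall x k, D x k = d k * x k.
Proof.
move=> Dd x k.
have [M M0 DM] := bop_coord_bounded D.
have dM : nrm (d k) <= M.
  have := DM (ell2_basis R k) k; rewrite ell2_norm_basis Dd ell2_scale_basis eqxx.
  by rewrite !mulr1.
have Dtr s : uniq s -> D (truncation x s) k = d k * truncation x s k.
  move=> us; rewrite {1}/truncation linear_sum.
  rewrite (eq_bigr (fun i => d i *: (x i *: ell2_basis R i))); last first.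
    by move=> i _; rewrite linearZ /= Dd !scalerA mulrC.
  rewrite !ell2_sum_coord mulr_sumr; apply: eq_bigr => i _.
  rewrite scalerA !ell2_scale_basis; have [->|ki] := eqVneq k i.
    by rewrite !mulr1.
  by rewrite !mulr0.
apply/eqP; rewrite -subr_eq0; apply/eqP/nrm_eq0/eqP.
rewrite eq_le nrm_ge0 andbT; apply/ler_addgt0Pl => e e0; rewrite addr0.
have eM : 0 < e / 2 / M by rewrite !divr_gt0.
have [s us xs] := truncation_approx x eM.
have -> : D x k - d k * x k =
    D (x - truncation x s) k - d k * (x - truncation x s) k.
  rewrite linearB.
  have subE (y z : ell2 R I) : (y - z) k = y k - z k by [].
  by rewrite !subE Dtr// mulrBr opprB addrA subrK.
have nrmN (c : R[i]) : nrm (- c) = nrm c by rewrite /nrm normrN.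
apply: le_trans (ler_nrmD _ _) _; rewrite nrmN nrmM.
have h1 := DM (x - truncation x s) k.
have h2 : nrm (d k) * nrm ((x - truncation x s) k) <= M * ell2_norm (x - truncation x s).
  by rewrite ler_pM ?nrm_ge0// ell2_coord.
have h3 : M * ell2_norm (x - truncation x s) <= e / 2.
  by rewrite -ler_pdivlMl// mulrC.
by lra.
Qed.

(** If every diagonal entry were at distance more than e from l, division by
    d k - l would be a bounded two-sided inverse of D - l. *)
Lemma spectrum_diagonal_approx (D : bop R I) (l : R[i]) (e : R) :
  diagonal_bop D -> spectrum D l -> 0 < e ->
  exists k c, D (ell2_basis R k) = c *: ell2_basis R k /\ nrm (c - l) <= e.
Proof.
move=> /choice[d Dd] Dl e0; apply: contrapT => far; apply: Dl.
have dle k : e < nrm (d k - l).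
  by rewrite ltNge; apply/negP => de; apply: far; exists k, (d k).
have dl0 k : d k - l != 0.
  by apply/eqP => dl; move: (lt_trans e0 (dle k)); rewrite dl nrm0 ltxx.
have mC k : nrm (d k - l)^-1 <= e^-1.
  have dp : 0 < nrm (d k - l) by exact: lt_trans (dle k).
  have -> : nrm (d k - l)^-1 = (nrm (d k - l))^-1.
    apply: (@mulfI _ (nrm (d k - l))); first by rewrite gt_eqF.
    rewrite -nrmM divff// divff ?(lt0r_neq0 dp)//.
    by rewrite -[1]/(1%:C%C) nrm_real normr1.
  by rewrite lef_pV2 ?posrE// ltW.
have E x k : (D - l *: bop_id) x k = (d k - l) * x k.
  rewrite mulrBl -(diagonal_bopE Dd).
  by [].
exists (multiplier mC); split; apply: bop_ext => x k; rewrite bop_compE bop_idE.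
  by rewrite E multiplierE mulrA divff// mul1r.
by rewrite multiplierE E mulrA mulVf// mul1r.
Qed.

End Multiplier.

(** * Joint eigenvectors *)

Section Eigenvectors.
Context {R : realType}.

Definition eigenbasis (I : choiceType) (A : bop R I) (k : I) (c : R[i]) :=
  A (ell2_basis R k) = c *: ell2_basis R k.

Lemma ell2_ext (I : choiceType) (x y : ell2 R I) : (forall k, x k = y k) -> x = y.
Proof. by move=> xy; apply/val_inj/funext => k; exact: xy. Qed.

Lemma eigenbasis_id (I : choiceType) (k : I) : eigenbasis (@bop_id R I) k 1.
Proof. by rewrite /eigenbasis scale1r. Qed.

Lemma eigenbasis_tens (I J : choiceType) (A : bop R I) (B : bop R J) i j c d :
  eigenbasis A i c -> eigenbasis B j d -> eigenbasis (tens A B) (i, j) (c * d).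
Proof.
move=> Ai Bj; rewrite /eigenbasis -tensv_basis tensE Ai Bj.
by apply: ell2_ext => k; rewrite [LHS]mulrACA.
Qed.

Context {I J : choiceType}.

Lemma dsum_inlE (A : bop R I) (B : bop R J) x i :
  dsum A B x (inl i) = A (ell2_sub (@Defs.inl_inj I J) x) i.
Proof. by []. Qed.

Lemma dsum_inrE (A : bop R I) (B : bop R J) x j :
  dsum A B x (inr j) = B (ell2_sub (@Defs.inr_inj I J) x) j.
Proof. by []. Qed.

Lemma ell2_sub_inl_basis i :
  ell2_sub (@Defs.inl_inj I J) (ell2_basis R (inl i)) = ell2_basis R i.
Proof. exact: ell2_ext. Qed.

Lemma ell2_sub_inr_basis j :
  ell2_sub (@Defs.inr_inj I J) (ell2_basis R (inr j)) = ell2_basis R j.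
Proof. exact: ell2_ext. Qed.

Lemma ell2_sub_inl_basis_inr j :
  ell2_sub (@Defs.inl_inj I J) (ell2_basis R (inr j)) = 0.
Proof. exact: ell2_ext. Qed.

Lemma ell2_sub_inr_basis_inl i :
  ell2_sub (@Defs.inr_inj I J) (ell2_basis R (inl i)) = 0.
Proof. exact: ell2_ext. Qed.

Lemma eigenbasis_dsuml (A : bop R I) (B : bop R J) i c :
  eigenbasis A i c -> eigenbasis (dsum A B) (inl i) c.
Proof.
move=> Ai; apply: ell2_ext => -[i'|j].
  by rewrite dsum_inlE ell2_sub_inl_basis Ai.
by rewrite dsum_inrE ell2_sub_inr_basis_inl linear0 ell2_scale_basis mulr0.
Qed.

Lemma eigenbasis_dsumr (A : bop R I) (B : bop R J) j c :
  eigenbasis B j c -> eigenbasis (dsum A B) (inr j) c.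
Proof.
move=> Bj; apply: ell2_ext => -[i|j'].
  by rewrite dsum_inlE ell2_sub_inl_basis_inr linear0 ell2_scale_basis mulr0.
by rewrite dsum_inrE ell2_sub_inr_basis Bj.
Qed.

Lemma dsum_basis_inr (A : bop R I) (B : bop R J) j j' :
  dsum A B (ell2_basis R (inr j)) (inr j') = B (ell2_basis R j) j'.
Proof. by rewrite dsum_inrE ell2_sub_inr_basis. Qed.

Lemma mxop_basis n (A : 'M[R[i]]_n) i j : mxop A (ell2_basis R j) i = A i j.
Proof.
rewrite /= /mxop_fun (bigD1 j)//= eqxx mulr1 big1 ?addr0//.
by move=> l lj; rewrite (negbTE lj) mulr0.
Qed.

End Eigenvectors.

(** * S is an isometry *)

Section Isometry.
Context {R : realType}.

Lemma nrm_ell1 n (w : ell1 R n) : nrm w = \sum_i nrm (w 0 i).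
Proof.
apply/complexI; rewrite nrmE rmorph_sum.
transitivity (\sum_i `|w 0 i|); first by [].
by apply: eq_bigr => i _; rewrite -nrmE.
Qed.

Lemma nrm_ell1_3 (w : ell1 R 3) :
  nrm w = nrm (w 0 0) + nrm (w 0 1) + nrm (w 0 ord_max).
Proof.
rewrite nrm_ell1 !big_ord_recr big_ord0 /= add0r.
by congr (nrm (w _ _) + nrm (w _ _) + nrm (w _ _)); apply/val_inj.
Qed.

Lemma phase (z : R[i]) : exists l : R[i], `|l| = 1 /\ z * l = (nrm z)%:C%C.
Proof.
have [->|z0] := eqVneq z 0; first by exists 1; rewrite normr1 mul0r nrm0.
exists (`|z| / z); rewrite nrmE mulrCA divff// mulr1; split => //.
by rewrite normf_div normr_id divff// normr_eq0.
Qed.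

Lemma sqr_sqrt3 : Num.sqrt 3 ^+ 2 = 3 :> R.
Proof. by rewrite sqr_sqrtr. Qed.

Lemma matI2E : @matI2 R = mx2 1 0 0 1.
Proof.
apply/matrixP => i j; rewrite !mxE.
by case: i => -[|[|//]] ?; case: j => -[|[|//]] ?.
Qed.

Lemma contractive_matI2 : contractive_op (mxop (@matI2 R)).
Proof. by rewrite matI2E; apply: contractive_mx2; ring. Qed.

Lemma contractive_matU : contractive_op (mxop (@matU R)).
Proof. by apply: contractive_mx2; have := sqr_sqrt3; lra. Qed.

Lemma contractive_matV : contractive_op (mxop (@matV R)).
Proof. by apply: contractive_mx2; have := sqr_sqrt3; lra. Qed.

Context (D : bop R int).

Lemma SmapE (z : ell1 R 3) x : Smap D z x =
  z 0 0 *: S1 D x + z 0 1 *: S2 D x + z 0 ord_max *: S3 D x.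
Proof. by []. Qed.

Lemma Smap_bounded (z : ell1 R 3) : contractive_op D ->
  forall x, ell2_norm (Smap D z x) <= nrm z * ell2_norm x.
Proof.
move=> cD x.
have cT M : contractive_op (mxop M) -> contractive_op (Ttilde D M).
  by move=> cM; exact: contractive_dsum.
have cI := @contractive_id R Lidx.
have cS1 : contractive_op (S1 D).
  apply: (contractive_dsum _ contractive_matI2).
  apply: contractive_tens (contractive_tens _ cI) cI.
  exact: cT contractive_matI2.
have cS2 : contractive_op (S2 D).
  apply: (contractive_dsum _ contractive_matU).
  apply: contractive_tens (contractive_tens cI _) cI.
  exact: cT contractive_matU.
have cS3 : contractive_op (S3 D).
  apply: (contractive_dsum _ contractive_matV).
  apply: contractive_tens (contractive_tens cI cI) _.
  exact: cT contractive_matV.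
have cZ c (A : bop R (Kidx)) : contractive_op A ->
    ell2_norm (c *: A x) <= nrm c * ell2_norm x.
  move=> cA; apply: le_trans (ell2_normZ_le _ _) _.
  by rewrite ler_wpM2l ?nrm_ge0.
rewrite SmapE nrm_ell1_3 !mulrDl.
apply: le_trans (ler_ell2_normD _ _) _; apply: lerD; last exact: cZ.
by apply: le_trans (ler_ell2_normD _ _) _; apply: lerD; exact: cZ.
Qed.

(** On the tensor product of three eigenvectors of D, each summand of S acts on its
    own leg, so that three independent eigenvalues of D are available at once. *)
Lemma Smap_eigenbasis (z : ell1 R 3) k1 k2 k3 c1 c2 c3 :
  eigenbasis D k1 c1 -> eigenbasis D k2 c2 -> eigenbasis D k3 c3 ->
  eigenbasis (Smap D z) (inl ((inr k1, inr k2), inr k3))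
    (z 0 0 * c1 + z 0 1 * c2 + z 0 ord_max * c3).
Proof.
move=> D1 D2 D3.
have T M k c : eigenbasis D k c -> eigenbasis (Ttilde D M) (inr k) c.
  exact: eigenbasis_dsumr.
have idL := @eigenbasis_id R Lidx.
have E1 : eigenbasis (S1 D) (inl ((inr k1, inr k2), inr k3)) (c1 * 1 * 1).
  exact: eigenbasis_dsuml (eigenbasis_tens (eigenbasis_tens (T _ _ _ D1) (idL _)) (idL _)).
have E2 : eigenbasis (S2 D) (inl ((inr k1, inr k2), inr k3)) (1 * c2 * 1).
  exact: eigenbasis_dsuml (eigenbasis_tens (eigenbasis_tens (idL _) (T _ _ _ D2)) (idL _)).
have E3 : eigenbasis (S3 D) (inl ((inr k1, inr k2), inr k3)) (1 * 1 * c3).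
  exact: eigenbasis_dsuml (eigenbasis_tens (eigenbasis_tens (idL _) (idL _)) (T _ _ _ D3)).
rewrite /eigenbasis SmapE E1 E2 E3 !scalerA -!scalerDl.
by rewrite !(mul1r, mulr1).
Qed.

(** The eigenvalues c1, c2, c3 of D are chosen close to unimodular numbers l1, l2, l3
    with z_i l_i = |z_i|; the corresponding joint eigenvector then almost attains
    |z_1| + |z_2| + |z_3|. *)
Lemma Smap_isometric : diagonal_bop D -> (bop_norm D <= 1%:E)%E ->
  unit_circle `<=` spectrum D -> isometric_to_bop (Smap D).
Proof.
move=> Ddiag Dcontr Dspec z.
have cD := bop_norm_contractive_op Dcontr.
apply/eqP; rewrite eq_le; apply/andP; split.
  apply: ge_ereal_sup => _ [x /= x1 <-]; rewrite lee_fin.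
  by apply: le_trans (Smap_bounded _ cD _) _; rewrite ler_piMr ?nrm_ge0.
apply/lee_addgt0Pr => e e0.
have z0 := nrm_ge0 z.
(* The total error is at most nrm z * e' <= e; the 1 + avoids dividing by 0. *)
pose e' := e / (1 + nrm z).
have e'0 : 0 < e' by rewrite divr_gt0// ltr_pwDl.
have [l1 [n1 zl1]] := phase (z 0 0).
have [l2 [n2 zl2]] := phase (z 0 1).
have [l3 [n3 zl3]] := phase (z 0 ord_max).
have [k1 [c1 [D1 lc1]]] := spectrum_diagonal_approx Ddiag (Dspec _ n1) e'0.
have [k2 [c2 [D2 lc2]]] := spectrum_diagonal_approx Ddiag (Dspec _ n2) e'0.
have [k3 [c3 [D3 lc3]]] := spectrum_diagonal_approx Ddiag (Dspec _ n3) e'0.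
pose b : Kidx := inl ((inr k1, inr k2), inr k3).
set c := z 0 0 * c1 + z 0 1 * c2 + z 0 ord_max * c3.
have Sb : eigenbasis (Smap D z) b c by exact: Smap_eigenbasis.
have cS : nrm c <= ell2_norm (Smap D z (ell2_basis R b)).
  apply: le_trans (ell2_coord _ b).
  by rewrite Sb ell2_scale_basis eqxx mulr1.
apply: (@le_trans _ _ ((nrm c + e)%:E)); last first.
  rewrite EFinD leeD2r//; apply: (@le_trans _ _ (ell2_norm (Smap D z (ell2_basis R b)))%:E).
    by rewrite lee_fin.
  apply: ereal_sup_ubound; exists (ell2_basis R b) => //=.
  by rewrite ell2_norm_basis.
rewrite lee_fin.
have zc : (nrm z)%:C%C = c + (z 0 0 * (l1 - c1) + z 0 1 * (l2 - c2) + z 0 ord_max * (l3 - c3)).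
  by rewrite nrm_ell1_3 !rmorphD /= -zl1 -zl2 -zl3 /c; ring.
have -> : nrm z = nrm ((nrm z)%:C%C : R[i]) by rewrite nrm_real ger0_norm.
rewrite zc; apply: le_trans (ler_nrmD _ _) _; rewrite lerD2l.
have nrmB (u v : R[i]) : nrm (u - v) = nrm (v - u) by rewrite /nrm distrC.
apply: (@le_trans _ _ (nrm z * e')).
  rewrite nrm_ell1_3 !mulrDl.
  apply: le_trans (ler_nrmD _ _) _; apply: lerD.
    apply: le_trans (ler_nrmD _ _) _; apply: lerD;
    by rewrite nrmM ler_wpM2l ?nrm_ge0// nrmB.
  by rewrite nrmM ler_wpM2l ?nrm_ge0// nrmB.
rewrite /e' mulrA ler_pdivrMr ?ltr_pwDl//.
by rewrite mulrC ler_wpM2l ?lerDr// ltW.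
Qed.

End Isometry.

(** * Comparison with MIN *)

Section MinNorm.
Context {R : realType}.

Definition ell1_basis (n : nat) (i : 'I_n) : ell1 R n := \row_j (j == i)%:R.

Lemma dual_ballP (n : nat) (f : {linear ell1 R n -> R[i]^o}) :
  dual_ball f <-> forall w, nrm (f w : R[i]) <= nrm w.
Proof.
split=> [f1 w|f1].
  have [/nrm_eq0 ->|w0] := eqVneq (nrm w) 0; first by rewrite linear0 !nrm0.
  have wp : 0 < nrm w by rewrite lt_def w0 nrm_ge0.
  have nZ (r : R) : nrm (r%:C%C *: w) = `|r| * nrm w.
    by rewrite -nrm_real; apply/complexI; rewrite rmorphM /= !nrmE normrZ.
  have : ((nrm (f ((nrm w)^-1%:C%C *: w) : R[i]))%:E <= 1%:E)%E.
    apply: le_trans f1; apply: ereal_sup_ubound.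
    exists ((nrm w)^-1%:C%C *: w) => //=.
    by rewrite nZ gtr0_norm ?invr_gt0// mulVf.
  rewrite linearZ lee_fin nrmM nrm_real gtr0_norm ?invr_gt0//.
  by rewrite ler_pdivrMl// mulr1.
apply: ge_ereal_sup => _ [w /= w1 <-]; rewrite lee_fin.
exact: le_trans (f1 w) w1.
Qed.

Lemma nrm_ell1_basis (i : 'I_3) : nrm (ell1_basis i) = 1.
Proof.
rewrite nrm_ell1 (bigD1 i)//= mxE eqxx big1 ?addr0.
  by rewrite -[X in nrm X]/(1%:C%C) nrm_real normr1.
by move=> j ji; rewrite mxE (negbTE ji) nrm0.
Qed.

Definition ell1_pairing (n : nat) (l : 'I_n -> R[i]) (w : ell1 R n) : R[i]^o :=
  \sum_i w 0 i * l i.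

Lemma ell1_pairing_linear n l : linear (@ell1_pairing n l).
Proof.
move=> c x y; rewrite /ell1_pairing scaler_sumr -big_split; apply: eq_bigr => i _.
by rewrite !mxE mulrDl -mulrA.
Qed.

HB.instance Definition _ n l :=
  GRing.isLinear.Build R[i] (ell1 R n) R[i]^o _ (@ell1_pairing n l)
    (@ell1_pairing_linear n l).

(** Pairing with the phases of the coordinates of z gives a functional of norm at
    most 1 whose value at z is the norm of z; with it, MIN at k = 1 dominates the
    given norm. *)
Lemma norming_functional n (z : ell1 R n) :
  exists2 f : {linear ell1 R n -> R[i]^o}, dual_ball f & f z = (nrm z)%:C%C.
Proof.
have /choice[l lP] := fun i => phase (z 0 i).
exists (@ell1_pairing n l).
  apply/dual_ballP => w; rewrite nrm_ell1.
  apply: le_trans (ler_nrm_sum _) _; apply: ler_sum => i _.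
  rewrite nrmM [nrm (l i)](_ : _ = 1) ?mulr1//.
  by apply/complexI; rewrite nrmE; case: (lP i).
rewrite nrm_ell1 rmorph_sum /= /ell1_pairing; apply: eq_bigr => i _.
by case: (lP i).
Qed.

Lemma mxop_norm_entry (A : 'M[R[i]]_1) : ((nrm (A 0 0))%:E <= mxop_norm A)%E.
Proof.
apply: (@le_trans _ _ (ell2_norm (mxop A (ell2_basis R 0)))%:E).
  by rewrite lee_fin -(mxop_basis A 0 0) ell2_coord.
by apply: ereal_sup_ubound; exists (ell2_basis R 0) => //=; rewrite ell2_norm_basis.
Qed.

(** Comparison with the Hilbert-Schmidt norm, by Cauchy-Schwarz in each row. *)
Lemma mxop_norm_hs (A : 'M[R[i]]_2) (M : R) : 0 <= M ->
  nrm (A 0 0) ^+ 2 + nrm (A 0 1) ^+ 2 + nrm (A 1 0) ^+ 2 + nrm (A 1 1) ^+ 2 <= M ^+ 2 ->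
  (mxop_norm A <= M%:E)%E.
Proof.
move=> M0 AM; apply: ge_ereal_sup => _ [x /= x1 <-]; rewrite lee_fin.
rewrite -ler_sqr ?nnegrE ?ell2_norm_ge0//; apply: le_trans AM.
have CS (a b y z : R[i]) : nrm (a * y + b * z) ^+ 2 <=
    (nrm a ^+ 2 + nrm b ^+ 2) * (nrm y ^+ 2 + nrm z ^+ 2).
  apply: (@le_trans _ _ ((nrm a * nrm y + nrm b * nrm z) ^+ 2)).
    rewrite lerXn2r ?nnegrE ?addr_ge0 ?mulr_ge0 ?nrm_ge0//.
    by rewrite -!nrmM ler_nrmD.
  rewrite -subr_ge0 (_ : _ - _ = (nrm a * nrm z - nrm b * nrm y) ^+ 2) ?sqr_ge0//.
  by ring.
have xE : nrm (x 0) ^+ 2 + nrm (x 1) ^+ 2 <= 1.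
  have : ((ell2_norm x ^+ 2)%:E <= 1)%E by rewrite lee_fin expr_le1 ?ell2_norm_ge0.
  rewrite -sqsumE sqsum_ord lee_fin !big_ord_recl big_ord0 addr0.
  by have -> : lift ord0 ord0 = 1 :> 'I_2 by apply/val_inj.
have -> : ell2_norm (mxop A x) ^+ 2 =
    nrm (A 0 0 * x 0 + A 0 1 * x 1) ^+ 2 + nrm (A 1 0 * x 0 + A 1 1 * x 1) ^+ 2.
  apply: EFin_inj; rewrite -sqsumE sqsum_ord /= /mxop_fun !big_ord_recl !big_ord0 !addr0.
  by have -> : lift ord0 ord0 = 1 :> 'I_2 by apply/val_inj.
apply: le_trans (lerD (CS _ _ _ _) (CS _ _ _ _)) _.
rewrite -mulrDl addrA ler_piMr// !addr_ge0 ?sqr_ge0//.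
Qed.

(** The element I_2 (x) e_1 + U (x) e_2 + V (x) e_3 of M_2(l^1(3)), whose two norms
    are compared. *)
Definition pencil : 'M[ell1 R 3]_2 :=
  \matrix_(i, j) (@matI2 R i j *: ell1_basis 0 + @matU R i j *: ell1_basis 1
                  + @matV R i j *: ell1_basis ord_max).

Lemma pencil_coord0 i j : pencil i j 0 0 = @matI2 R i j.
Proof. by rewrite !mxE /= mulr1 !mulr0 !addr0. Qed.

Lemma pencil_coord1 i j : pencil i j 0 1 = @matU R i j.
Proof. by rewrite !mxE /= mulr1 !mulr0 add0r addr0. Qed.

Lemma pencil_coord2 i j : pencil i j 0 ord_max = @matV R i j.
Proof. by rewrite !mxE /= mulr1 !mulr0 !add0r. Qed.

(** The matrices I_2, U, V have Hilbert-Schmidt norm squared 2, and for the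
    corresponding inner product U is orthogonal to I_2 and V, while
    (I_2, V) = tr(V) = 1. So the left-hand side is
    2 (|a|^2 + |b|^2 + |c|^2) + 2 Re(a conj(c)), which is at most 6 + 2. *)
Lemma pencil_sqr_entries (a b c : R[i]) (A := fun i j => @matI2 R i j * a + @matU R i j * b + @matV R i j * c) :
  nrm a <= 1 -> nrm b <= 1 -> nrm c <= 1 ->
  nrm (A 0 0) ^+ 2 + nrm (A 0 1) ^+ 2 + nrm (A 1 0) ^+ 2 + nrm (A 1 1) ^+ 2 <= 8.
Proof.
have sq (z : R[i]) : nrm z <= 1 -> nrm z ^+ 2 <= 1 by move=> ?; rewrite expr_le1 ?nrm_ge0.
move=> /sq a1 /sq b1 /sq c1.
have s3 := @sqr_sqrt3 R; set s := Num.sqrt 3 in s3.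
rewrite /A matI2E /matU /matV !mxE /= -/s.
case: a b c @A a1 b1 c1 => [p p'] [q q'] [r r'] _; rewrite !nrm_sq /=.
move=> a1 b1 c1.
have h1 := sqr_ge0 (p - r); have h2 := sqr_ge0 (p' - r').
rewrite !(mul0r, mul1r, subr0, addr0, add0r).
set X := (X in X <= _).
have -> : X = 2 * (p ^+ 2 + p' ^+ 2) + (1 + s ^+ 2) / 2 * (q ^+ 2 + q' ^+ 2)
   + (1 + s ^+ 2) / 2 * (r ^+ 2 + r' ^+ 2) + 2 * (p * r + p' * r').
  by rewrite /X; field.
by rewrite s3; nra.
Qed.

Lemma pencil_MIN (f : {linear ell1 R 3 -> R[i]^o}) :
  dual_ball f -> (mxop_norm (map_mx f pencil : 'M[R[i]]_2) <= (Num.sqrt 8)%:E)%E.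
Proof.
move=> /dual_ballP f1; apply: mxop_norm_hs; rewrite ?sqrtr_ge0// sqr_sqrtr//.
have fE i j : (map_mx f pencil : 'M[R[i]]_2) i j = @matI2 R i j * f (ell1_basis 0)
    + @matU R i j * f (ell1_basis 1) + @matV R i j * f (ell1_basis ord_max).
  by rewrite mxE [pencil i j]mxE !linearD !linearZ.
rewrite !fE; apply: pencil_sqr_entries; by rewrite (le_trans (f1 _))// nrm_ell1_basis.
Qed.

Context (D : bop R int).

Lemma Smap_basis_inr (z : ell1 R 3) (i j : 'I_2) :
  Smap D z (ell2_basis R (inr j)) (inr i) =
  z 0 0 * @matI2 R i j + z 0 1 * @matU R i j + z 0 ord_max * @matV R i j.
Proof.
rewrite SmapE -!mxop_basis.
rewrite -(dsum_basis_inr (That1 D) (mxop matI2)) -(dsum_basis_inr (That2 D) (mxop matU)).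
by rewrite -(dsum_basis_inr (That3 D) (mxop matV)).
Qed.

(** Restricted to the summand C^2 of K, the pencil acts as
    I (x) I + U (x) U + V (x) V on C^2 (x) C^2. As the three matrices are real
    orthogonal, each term fixes e_0 (x) e_0 + e_1 (x) e_1, so this vector is
    multiplied by 3. *)
Lemma pencil_induced : (3%:E <= bop_mx_norm (map_mx (Smap D) pencil))%E.
Proof.
(* The vector e_0 (x) e_0 + e_1 (x) e_1 has norm sqrt 2. *)
pose c : R := (Num.sqrt 2)^-1.
have c2 : c ^+ 2 = 2^-1 by rewrite exprVn sqr_sqrtr.
have c0 : 0 <= c by rewrite invr_ge0 sqrtr_ge0.
pose h (j : 'I_2) : ell2 R Kidx := c%:C%C *: ell2_basis R (inr j).
pose y (i : 'I_2) := \sum_j (map_mx (Smap D) pencil) i j (h j).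
apply: (@le_trans _ _ (copies_norm y)%:E); last first.
  apply: ereal_sup_ubound; exists h => //=.
  rewrite /copies_norm -[leRHS]sqrtr1 ler_sqrt// !big_ord_recl big_ord0 addr0.
  have hj j : ell2_norm (h j) ^+ 2 <= 2^-1.
    rewrite -c2 lerXn2r ?nnegrE ?ell2_norm_ge0// (le_trans (ell2_normZ_le _ _))//.
    by rewrite ell2_norm_basis mulr1 nrm_real ger0_norm.
  by apply: le_trans (lerD (hj _) (hj _)) _; lra.
rewrite lee_fin -ler_sqr ?nnegrE ?sqrtr_ge0// sqr_sqrtr; last first.
  by rewrite sumr_ge0// => i _; rewrite sqr_ge0.
have yi i : (3 * c) ^+ 2 <= ell2_norm (y i) ^+ 2.
  rewrite lerXn2r ?nnegrE ?ell2_norm_ge0 ?mulr_ge0//.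
  apply: le_trans (ell2_coord (y i) (inr i)).
  have -> : y i (inr i) = (3 * c)%:C%C.
    rewrite ell2_sum_coord.
    transitivity (\sum_j c%:C%C * (@matI2 R i j ^+ 2 + @matU R i j ^+ 2
                                    + @matV R i j ^+ 2)).
      apply: eq_bigr => j _; rewrite mxE linearZ.
      transitivity (c%:C%C * Smap D (pencil i j) (ell2_basis R (inr j)) (inr i)) => //.
      rewrite Smap_basis_inr pencil_coord0 pencil_coord1 pencil_coord2.
      by rewrite !expr2.
    have s3 := @sqr_sqrt3 R.
    rewrite !big_ord_recl big_ord0 addr0 -mulrDr mulrC rmorphM /=; congr (_ * _).
    rewrite matI2E /matU /matV !mxE /= -!rmorphXn -!rmorphD /=; congr (_%:C%C).
    by case: ifP => _; rewrite ?sqrrN !expr_div_n s3; lra.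
  by rewrite nrm_real ler_norm.
rewrite !big_ord_recl big_ord0 addr0.
apply: le_trans (lerD (yi _) (yi _)); rewrite exprMn c2; lra.
Qed.

Lemma bop_mx_norm1_le (w : 'M[ell1 R 3]_1) : contractive_op D ->
  (bop_mx_norm (map_mx (Smap D) w) <= (nrm (w 0 0))%:E)%E.
Proof.
move=> cD; apply: ge_ereal_sup => _ [h /= h1 <-]; rewrite lee_fin.
have cn (g : 'I_1 -> ell2 R Kidx) : copies_norm g = ell2_norm (g 0).
  by rewrite /copies_norm big_ord1 sqrtr_sqr ger0_norm ?ell2_norm_ge0.
rewrite cn big_ord1 mxE; rewrite cn in h1.
apply: le_trans (Smap_bounded _ cD _) _.
by rewrite ler_piMr ?nrm_ge0.
Qed.

(** A complete isometry T is in particular contractive at k = 1. Composition with T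
    then maps the dual ball into itself, so the MIN norm of the image of the pencil
    obeys the bound sqrt 8 that holds for the pencil, whereas T should preserve
    its S-norm, which is at least 3. *)
Lemma Smap_not_MIN : contractive_op D ->
  ~ completely_isometric (induced_opspace (Smap D)) (MIN (ell1 R 3)).
Proof.
move=> cD [T [_ Tiso]].
have Tcontr (z : ell1 R 3) : nrm (T z : ell1 R 3) <= nrm z.
  have [f f1 fz] := norming_functional (T z : ell1 R 3).
  pose w : 'M[ell1 R 3]_1 := const_mx z.
  rewrite -lee_fin.
  have -> : (nrm (T z : ell1 R 3))%:E = (nrm ((map_mx f (map_mx T w : 'M[ell1 R 3]_1) : 'M[R[i]]_1) 0 0))%:E.
    by rewrite !mxE fz nrm_real ger0_norm ?nrm_ge0.
  apply: le_trans (mxop_norm_entry _) _.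
  apply: (@le_trans _ _ (@os_norm R (MIN (ell1 R 3)) 1 (map_mx T w))).
    by apply: ereal_sup_ubound; exists f.
  rewrite Tiso//; apply: le_trans (bop_mx_norm1_le w cD) _.
  by rewrite mxE.
have := Tiso 2 isT (pencil : 'M[induced_opspace (Smap D)]_2).
apply/eqP; rewrite lt_eqF//.
apply: (@lt_le_trans _ _ 3%:E); last exact: pencil_induced.
apply: (@le_lt_trans _ _ (Num.sqrt 8)%:E); last first.
  rewrite lte_fin -(ltr_pXn2r (n := 2))// ?nnegrE ?sqrtr_ge0// sqr_sqrtr//; lra.
apply: ge_ereal_sup => _ [f f1 <-].
pose g : {linear ell1 R 3 -> R[i]^o} := f \o (T : {linear ell1 R 3 -> ell1 R 3}).
rewrite (_ : map_mx f _ = map_mx g pencil); last by apply/matrixP => i j; rewrite !mxE.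
apply: pencil_MIN; apply/dual_ballP => z.
by apply: le_trans (Tcontr z); exact: (dual_ballP f).1.
Qed.

End MinNorm.

Theorem mainTheorem5 (R : realType) (D : bop R int)
    (D_diagonal : diagonal_bop D)
    (D_contraction : (bop_norm D <= 1%:E)%E)
    (D_spectrum : unit_circle `<=` spectrum D) :
  isometric_to_bop (Smap D) /\
  ~ completely_isometric (induced_opspace (Smap D)) (MIN (ell1 R 3)).
Proof.
split; first exact: Smap_isometric.
exact: Smap_not_MIN (bop_norm_contractive_op D_contraction).
Qed.
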